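(* Let $G$ be the group $U_{(n,m)}=\langle x,y : x^{2n}=y^m=1,\ x^{-1}yx=y^{-1}\rangle$, where $n\ge 2$ and $m\ge 3$. Then the commuting conjugacy class graph $\Gamma(G)$ is not CN-hyperenergetic.
   Context: For a finite non-abelian group $G$, the commuting conjugacy class graph $\Gamma(G)$ is the simple undirected graph whose vertices are the conjugacy classes of the non-central elements of $G$; two distinct vertices $a^G$ and $b^G$ are adjacent if there exist $a'\in a^G$, $b'\in b^G$ with $a'b'=b'a'$. For a finite simple graph $\mathcal{G}$ with vertices $v_1,\dots,v_N$, the common neighbourhood matrix $CN(\mathcal{G})$ is the $N\times N$ matrix whose $(i,j)$ entry is, for $i\ne j$, the number of vertices other than $v_i,v_j$ adjacent to both $v_i$ and $v_j$, and is $0$ for $i=j$. The CN-energy $E_{CN}(\mathcal{G})$ is the sum of the absolute values of the eigenvalues of $CN(\mathcal{G})$, counted with multiplicity. With $K_N$ the complete graph on $N=|V(\mathcal{G})|$ vertices, $\mathcal{G}$ is CN-hyperenergetic if $E_{CN}(\mathcal{G})>E_{CN}(K_N)$. *)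

(* Defs.v *)
From HB Require Import structures.
From mathcomp Require Import all_boot all_order all_algebra all_fingroup.
From mathcomp Require Import all_solvable all_field.

Set Implicit Arguments.
Unset Strict Implicit.
Unset Printing Implicit Defensive.

Import Order.TTheory GRing.Theory Num.Theory.

Record sgraph := SGraph {
  vertex :> finType;
  adj : rel vertex;
  adj_sym : symmetric adj;
  adj_irr : irreflexive adj
}.

Section CompleteGraph.
Variable N : nat.

Definition complete_adj : rel 'I_N := fun i j => i != j.

Fact complete_adj_sym : symmetric complete_adj.
Proof. by move=> i j; rewrite /complete_adj eq_sym. Qed.

Fact complete_adj_irr : irreflexive complete_adj.
Proof. by move=> i; rewrite /complete_adj eqxx. Qed.

Definition complete_graph : sgraph := SGraph complete_adj_sym complete_adj_irr.

End CompleteGraph.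

Section CNEnergy.
Local Open Scope ring_scope.
Implicit Type Gr : sgraph.

Definition common_neighbours Gr (u v : Gr) : {set Gr} :=
  [set w : Gr | [&& w != u, w != v, adj u w & adj v w]].

(* The vertices are numbered by the canonical enumeration of the type. *)
Definition CN_matrix Gr : 'M[algC]_#|Gr| :=
  \matrix_(i, j) if i == j then 0
                 else #|common_neighbours (enum_val i) (enum_val j)|%:R.

(* The list of the complex roots of the characteristic polynomial, repeated    *)
(* according to multiplicity; see eigenvalue_seqE.                             *)
Definition eigenvalue_seq n (A : 'M[algC]_n) : seq algC :=
  sval (closed_field_poly_normal (char_poly A)).

Fact eigenvalue_seqE n (A : 'M[algC]_n) :
  char_poly A = \prod_(z <- eigenvalue_seq A) ('X - z%:P).
Proof.
rewrite /eigenvalue_seq; case: closed_field_poly_normal => s /= ->.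
by rewrite (monicP (char_poly_monic A)) scale1r.
Qed.

(* A sum of norms, hence a nonnegative real element of algC, so the partial    *)
(* order of algC compares any two energies.                                    *)
Definition CN_energy Gr : algC :=
  \sum_(z <- eigenvalue_seq (CN_matrix Gr)) `|z|.

Definition CN_hyperenergetic Gr : Prop :=
  CN_energy (complete_graph #|Gr|) < CN_energy Gr.

End CNEnergy.

Section CommutingConjugacyClassGraph.
Local Open Scope group_scope.
Variables (gT : finGroupType) (G : {group gT}).

Definition noncentral_classes : {set {set gT}} :=
  [set x ^: G | x in G :\: 'Z(G)].

Definition ccc_vertex : finType := {A : {set gT} | A \in noncentral_classes}.

Definition ccc_adj : rel ccc_vertex := fun A B =>
  (A != B) && [exists a in val A, [exists b in val B, a * b == b * a]].

Fact ccc_adj_sym : symmetric ccc_adj.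
Proof.
move=> A B; rewrite /ccc_adj eq_sym; congr (_ && _).
by apply/exists_inP/exists_inP => -[a Aa /exists_inP[b Bb ab]];
  exists b => //; apply/exists_inP; exists a; rewrite // eq_sym.
Qed.

Fact ccc_adj_irr : irreflexive ccc_adj.
Proof. by move=> A; rewrite /ccc_adj eqxx. Qed.

Definition ccc_graph : sgraph := SGraph ccc_adj_sym ccc_adj_irr.

End CommutingConjugacyClassGraph.

(* "_ \isog Grp _" characterises the largest finite quotient of the presented  *)
(* group. Here this is the presented group itself: its subgroup generated by y *)
(* is finite and normal, with finite cyclic quotient generated by x.           *)
Definition is_Unm (gT : finGroupType) (G : {group gT}) (n m : nat) : Prop :=
  (G \isog Grp (x : y : x ^+ (2 * n)%N = y ^+ m = 1,
                        x^-1 * y * x = y^-1))%g.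

(* Main.v *)
Require Import Defs.
From mathcomp Require Import all_boot all_order all_algebra all_fingroup.
From mathcomp Require Import all_solvable all_field.

(** The graph of U_(n,m) fails to be CN-hyperenergetic merely because it is
    disconnected, and the argument has a graph half and a group half.

    For an arbitrary graph with adjacency matrix B, two-step walks give
    CN = B^2 - D, where D is the diagonal matrix of degrees.  Both B^2 and D are
    positive semidefinite, so in an orthonormal eigenbasis of CN each eigenvalue
    is a difference of two nonnegative diagonal entries; its absolute value is
    at most their sum, and summing gives
    E_CN <= tr B^2 + tr D = 2 (sum of the degrees)
    ([CN_energy_le_degree_sum]).  On the other side, CN of the complete graph on
    N vertices has trace 0 and the eigenvalue (N - 1)(N - 2), belonging to the
    all-one vector; the remaining eigenvalues sum to the opposite of that one,
    whence E_CN(K_N) >= 2 (N - 1)(N - 2) ([CN_energy_complete_ge]).  Finally, a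
    graph split into nonempty parts of sizes a and b, without edges between
    them, has degree sum at most
    a (a - 1) + b (b - 1) <= (a + b - 1)(a + b - 2),
    so it is not CN-hyperenergetic ([disconnected_not_CN_hyperenergetic]).

    In G = <x, y> the subgroup C = C_G(y) is normal and proper.  An element
    x^i y^j fixes y under conjugation when i is even and inverts it when i is
    odd.  Hence an element b outside C inverts y, and if b commutes with
    a = x^k y^l in C, then, k being even, y^l commutes with b as well, so y^l is
    its own inverse and a is central ([commuting_in_centralizer]).  The classes
    inside C and those outside it are therefore not joined by edges; the classes
    of y and x show that both kinds occur.  All of this presupposes that G is not
    abelian, which holds because it maps onto the dihedral group of order 2m
    ([Unm_generators]). *)

Set Implicit Arguments.
Unset Strict Implicit.
Unset Printing Implicit Defensive.

Import Order.TTheory GRing.Theory Num.Theory.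

(** * Sums of absolute values of eigenvalues *)

Section Spectra.
Local Open Scope ring_scope.
Local Open Scope sesquilinear_scope.

Lemma char_poly_similar (F : fieldType) n (P A : 'M[F]_n) :
  P \in unitmx -> char_poly (invmx P *m A *m P) = char_poly A.
Proof.
move=> Pu; rewrite /char_poly.
pose Q := map_mx polyC P; pose Q' := map_mx polyC (invmx P).
have QQ' : Q *m Q' = 1%:M by rewrite -map_mxM mulmxV // map_mx1.
have -> : char_poly_mx (invmx P *m A *m P) = Q' *m char_poly_mx A *m Q.
  rewrite /char_poly_mx mulmxBr mulmxBl !map_mxM; congr (_ - _).
  by rewrite mul_mx_scalar -scalemxAl -map_mxM mulVmx // map_mx1 scalemx1.
by rewrite -mulmxA det_mulmx mulrC -det_mulmx -mulmxA QQ' mulmx1.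
Qed.

(** The spectral theorem diagonalises a normal matrix, and similar matrices have
    the same characteristic polynomial; the two lists of its roots then agree up
    to order. *)
Lemma sum_eigenvalue_seq_normal n (A : 'M[algC]_n) (f : algC -> algC) :
  A \is normalmx ->
  \sum_(z <- eigenvalue_seq A) f z = \sum_i f (spectral_diag A 0 i).
Proof.
move=> nA; pose s := [seq spectral_diag A 0 i | i <- enum 'I_n].
suffices eq_s : perm_eq (eigenvalue_seq A) s.
  by rewrite (perm_big _ eq_s) big_map big_enum.
apply: prod_XsubC_eq; rewrite -eigenvalue_seqE {1}(orthomx_spectralP nA).
rewrite char_poly_similar ?spectral_unit // char_poly_trig ?diag_mx_is_trig //.
by rewrite big_map big_enum; apply: eq_bigr => i _; rewrite !mxE eqxx.
Qed.

Definition psd n (A : 'M[algC]_n) :=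
  forall v : 'rV_n, 0 <= (v *m A *m v^t*) 0 0.

Lemma psd_mul_adjoint m n (B : 'M[algC]_(n, m)) : psd (B *m B^t*).
Proof.
move=> v; rewrite mulmxA -mulmxA -map_mxM -trmx_mul mxE.
by apply: sumr_ge0 => i _; rewrite !mxE mul_conjC_ge0.
Qed.

Lemma psd_diag n (d : 'rV[algC]_n) : (forall i, 0 <= d 0 i) -> psd (diag_mx d).
Proof.
move=> d_ge0 v; rewrite mxE; apply: sumr_ge0 => i _.
by rewrite mul_mx_diag !mxE mulrAC mulr_ge0 ?mul_conjC_ge0.
Qed.

(** In an orthonormal eigenbasis the eigenvalues of P - Q are differences
    p_i - q_i of diagonal entries of positive semidefinite matrices, so that
    |p_i - q_i| <= p_i + q_i; a unitary change of basis preserves the traces. *)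
Lemma sum_norm_eigenvalue_le n (P Q : 'M[algC]_n) :
    psd P -> psd Q -> P - Q \is normalmx ->
  \sum_(z <- eigenvalue_seq (P - Q)) `|z| <= \tr P + \tr Q.
Proof.
move=> psdP psdQ nPQ; rewrite sum_eigenvalue_seq_normal //.
set U := spectralmx (P - Q).
have Uu : U \is unitarymx by apply: spectral_unitarymx.
(* [c A] is A expressed in the eigenbasis of P - Q. *)
pose c (A : 'M_n) := U *m A *m U^t*.
have c_ge0 A i : psd A -> 0 <= c A i i.
  move=> /(_ (row i U)); rewrite -row_mul /c !mxE.
  by congr (0 <= _); apply: eq_bigr => k _; rewrite !mxE.
have trc A : \tr A = \sum_i c A i i.
  rewrite -[RHS]/(\tr (c A)) mxtrace_mulC mulmxA -invmx_unitary //.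
  by rewrite mulVmx ?mul1mx // unitarymx_unit.
rewrite !trc -big_split; apply: ler_sum => i _.
have -> : spectral_diag (P - Q) 0 i = c P i i - c Q i i.
  have -> : c P i i - c Q i i = c (P - Q) i i.
    by rewrite /c mulmxBr mulmxBl !mxE.
  rewrite /c {2}(orthomx_spectralP nPQ) -/U invmx_unitary // !mulmxA.
  by rewrite (unitarymxP Uu) mul1mx mulmxtVK // !mxE eqxx.
by rewrite (le_trans (ler_normB _ _)) // !ger0_norm ?c_ge0 //.
Qed.

Lemma size_eigenvalue_seq n (A : 'M[algC]_n) : size (eigenvalue_seq A) = n.
Proof.
have := size_char_poly A; rewrite eigenvalue_seqE size_prod_XsubC.
by case.
Qed.

Lemma sum_eigenvalue_seq n (A : 'M[algC]_n) :
  \sum_(z <- eigenvalue_seq A) z = \tr A.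
Proof.
case: n A => [|n] A.
  by rewrite /mxtrace big_ord0 (size0nil (size_eigenvalue_seq A)) big_nil.
apply: oppr_inj; rewrite -(char_poly_trace A (ltn0Sn n)) eigenvalue_seqE.
by rewrite -coefPn_prod_XsubC size_eigenvalue_seq.
Qed.

(** When the trace is 0 the other eigenvalues sum to - a, so that by the
    triangle inequality they contribute at least |a| again. *)
Lemma sum_norm_eigenvalue_ge n (A : 'M[algC]_n) a :
    \tr A = 0 -> eigenvalue A a ->
  2 * `|a| <= \sum_(z <- eigenvalue_seq A) `|z|.
Proof.
move=> trA0; rewrite eigenvalue_root_char eigenvalue_seqE root_prod_XsubC => sa.
move: trA0; rewrite -sum_eigenvalue_seq !(big_rem a sa) /= mulr_natl mulr2n.
move=> /(canRL (addKr _)); rewrite addr0 lerD2l -normrN => <-.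
exact: ler_norm_sum.
Qed.

End Spectra.

(** * The CN-energy of a graph *)

Section Energy.
Local Open Scope ring_scope.
Local Open Scope sesquilinear_scope.

Definition degree (Gr : sgraph) (u : Gr) : nat := #|[set w | adj u w]|.

(** CN is the square of the adjacency matrix minus the diagonal matrix of
    degrees, and both of these have the degree sum as trace. *)
Lemma CN_energy_le_degree_sum (Gr : sgraph) :
  CN_energy Gr <= (2 * \sum_(u : Gr) degree u)%:R.
Proof.
pose B : 'M[algC]_#|Gr| := \matrix_(i, j) (adj (enum_val i) (enum_val j))%:R.
pose d : 'rV[algC]_#|Gr| := \row_i (degree (enum_val i))%:R.
have Breal : B^t* = B.
  by apply/matrixP=> i j; rewrite !mxE rmorph_nat adj_sym.
have BB i j : (B *m B^t*) i j =
    #|[set w | adj (enum_val i) w && adj (enum_val j) w]|%:R.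
  rewrite Breal mxE -sum1dep_card natr_sum [RHS]big_mkcond /=.
  rewrite [RHS](reindex _ (onW_bij _ (@enum_val_bij Gr))) /=.
  apply: eq_bigr => k _; rewrite !mxE [adj (enum_val k) _]adj_sym.
  by rewrite -natrM mulnb; case: (_ && _).
have CN_eq : CN_matrix Gr = B *m B^t* - diag_mx d.
  apply/matrixP=> i j; rewrite [RHS]mxE BB !mxE.
  case: eqVneq => [->|ij].
    rewrite mulr1n /degree; under eq_finset => w do rewrite andbb.
    by rewrite subrr.
  rewrite subr0; congr (#|pred_of_set _|%:R); apply/setP=> w; rewrite !inE.
  have [->|_] := eqVneq w (enum_val i); first by rewrite adj_irr.
  by have [->|_] := eqVneq w (enum_val j); rewrite ?adj_irr ?andbF.
have tr_d : \tr (diag_mx d) = (\sum_(u : Gr) degree u)%:R.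
  rewrite mxtrace_diag natr_sum.
  rewrite [RHS](reindex _ (onW_bij _ (@enum_val_bij Gr))) /=.
  by apply: eq_bigr => i _; rewrite mxE.
have tr_BB : \tr (B *m B^t*) = \tr (diag_mx d).
  rewrite mxtrace_diag; apply: eq_bigr => i _; rewrite BB mxE /degree.
  by under eq_finset => w do rewrite andbb.
rewrite mul2n -addnn natrD -{1}tr_d -tr_BB -tr_d /CN_energy CN_eq.
apply: sum_norm_eigenvalue_le.
- exact: psd_mul_adjoint.
- by apply: psd_diag => i; rewrite mxE ler0n.
have CN_symm : (CN_matrix Gr)^t* = CN_matrix Gr.
  apply/matrixP=> i j; rewrite !mxE eq_sym.
  case: eqP => _; first exact: rmorph0.
  rewrite rmorph_nat; congr (#|pred_of_set _|%:R); apply/setP=> w; rewrite !inE.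
  by rewrite andbCA [adj (enum_val j) w && _]andbC.
by rewrite -CN_eq qualifE /= CN_symm.
Qed.

(** Here CN has 0 on the diagonal and N - 2 elsewhere, so that the all-one
    vector is an eigenvector for (N - 1)(N - 2). *)
Lemma CN_energy_complete_ge N : (0 < N)%N ->
  (2 * (N.-1 * N.-2))%:R <= CN_energy (complete_graph N).
Proof.
move=> N_gt0; pose A := CN_matrix (complete_graph N).
have cardN : #|complete_graph N| = N by rewrite card_ord.
have AE i j : A i j = if i == j then 0 else (N.-2)%:R.
  rewrite mxE; case: eqVneq => // ij; congr (_%:R).
  set u := enum_val i; set v := enum_val j.
  have uv : u != v by rewrite (inj_eq enum_val_inj).
  have -> : common_neighbours u v = [set: complete_graph N] :\ u :\ v.
    apply/setP=> w; rewrite !inE /= /complete_adj ![_ == w]eq_sym.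
    by case: (w == u); case: (w == v).
  have cardD1 : N = (#|[set: complete_graph N] :\ u|.+1)%N.
    by rewrite -[LHS]cardN -cardsT (cardsD1 u) inE.
  have := cardsD1 v ([set: complete_graph N] :\ u).
  rewrite !inE [v == u]eq_sym uv add1n => cardD2.
  by rewrite [in RHS]cardD1 cardD2.
have trA : \tr A = 0 by rewrite /mxtrace big1 // => i _; rewrite AE eqxx.
have eigA : eigenvalue A (N.-1 * N.-2)%:R.
  apply/eigenvalueP; exists (const_mx 1).
    apply/matrixP=> i j; rewrite !mxE mulr1 (bigD1 j) //= AE eqxx mulr0 add0r.
    rewrite (eq_bigr (fun=> (N.-2)%:R)) => [|k kj].
      by rewrite sumr_const cardC1 card_ord cardN natrM mulr_natl.
    by rewrite AE (negPf kj) mxE mul1r.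
  apply/eqP=> /rowP/(_ (enum_rank (Ordinal N_gt0 : complete_graph N))).
  by rewrite !mxE => /eqP; rewrite oner_eq0.
have := sum_norm_eigenvalue_ge trA eigA.
by rewrite normr_nat -natrM.
Qed.

(** The degree sum is largest when both parts are complete, and
    (a + 1) a + (b + 1) b <= (a + b + 1)(a + b) for parts of sizes a + 1 and
    b + 1. *)
Lemma disconnected_degree_sum (Gr : sgraph) (S : {set Gr}) (s t : Gr) :
    s \in S -> t \notin S ->
    (forall u v, u \in S -> v \notin S -> ~~ adj u v) ->
  (\sum_(u : Gr) degree u <= #|Gr|.-1 * #|Gr|.-2)%N.
Proof.
move=> Ss S't no_edge.
have deg_le (T : {set Gr}) u :
    u \in T -> (forall v, v \notin T -> ~~ adj u v) -> (degree u <= #|T|.-1)%N.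
  move=> Tu noT; rewrite (cardsD1 u) Tu /=; apply/subset_leq_card/subsetP=> w.
  rewrite !inE => uw; apply/andP; split.
    by apply: contraTneq uw => ->; rewrite adj_irr.
  by apply: contraTT uw; apply: noT.
rewrite (bigID (mem S)) /=.
have leS : (\sum_(u in S) degree u <= #|S| * #|S|.-1)%N.
  rewrite -sum_nat_const leq_sum // => u Su.
  by apply: deg_le => // v; apply: no_edge.
have leS' : (\sum_(u | u \notin S) degree u <= #|~: S| * #|~: S|.-1)%N.
  rewrite -sum_nat_const (eq_bigl [in ~: S]) => [|u]; last by rewrite inE.
  apply: leq_sum => u; rewrite inE => S'u.
  apply: deg_le => [|v]; first by rewrite inE.
  by rewrite inE negbK adj_sym => Sv; apply: no_edge.
apply: leq_trans (leq_add leS leS') _; rewrite -(cardsC S).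
have: (0 < #|S|)%N by apply/card_gt0P; exists s.
have: (0 < #|~: S|)%N by apply/card_gt0P; exists t; rewrite inE.
(* The parts now have sizes [a.+1] and [b.+1]. *)
case: #|S| #|~: S| => // a [|b] // _ _; rewrite addSn addnS /= mulnDr.
by rewrite leq_add // leq_mul // ltnS ?leq_addr ?leq_addl.
Qed.

(** Twice the degree sum bounds the energy from above, and is at most the lower
    bound 2 (N - 1)(N - 2) for the energy of the complete graph. *)
Lemma disconnected_not_CN_hyperenergetic
    (Gr : sgraph) (S : {set Gr}) (s t : Gr) :
    s \in S -> t \notin S ->
    (forall u v, u \in S -> v \notin S -> ~~ adj u v) ->
  ~ CN_hyperenergetic Gr.
Proof.
move=> Ss S't no_edge hyper.
have N_gt0 : (0 < #|Gr|)%N by apply/card_gt0P; exists s.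
have /(lt_le_trans hyper) := CN_energy_le_degree_sum Gr.
move=> /(le_lt_trans (CN_energy_complete_ge N_gt0)).
rewrite ltr_nat ltn_pmul2l // ltnNge.
by rewrite (disconnected_degree_sum Ss S't no_edge).
Qed.

End Energy.

(** * The groups U_(n,m) *)

Local Open Scope group_scope.

Lemma abelian_join_cycles (gT : finGroupType) (x y : gT) :
  commute x y -> abelian (<[x]> <*> <[y]>).
Proof.
move=> cxy; rewrite abelianY !cycle_abelian cycle_subG /=.
by rewrite cent_cycle; apply/cent1P.
Qed.

(** If the generators x and y commuted, then x = x^-1 would leave at most
    2 * 2 < 2m elements in <x><y>. *)
Lemma dihedral_nonabelian m : 2 < m -> ~~ abelian [set: 'D_m.*2].
Proof.
move=> m_gt2; have m_gt1 := ltnW m_gt2.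
case/existsP: (isoGrp_hom (Grp_dihedral m_gt1)) => -[x y] /=.
case/eqP=> defD _ y21 xy.
apply/negP=> abD; have cxy : commute x y by apply: (centsP abD); rewrite inE.
have x2 : x ^+ 2 = 1.
  by rewrite expgS expg1 -{1}[x](invgK x) -xy conjgE cxy mulKg mulVg.
have oX : #[x] <= 2 by rewrite dvdn_leq // order_dvdn x2.
have oY : #[y] <= 2 by rewrite dvdn_leq // order_dvdn y21.
have: #|[set: 'D_m.*2]| <= 2 * 2.
  rewrite -defD cent_joinEl ?cycle_subG //; last first.
    by rewrite /= cent_cycle; apply/cent1P.
  apply: leq_trans (leq_mul oX oY); rewrite [leqRHS]mul_cardG.
  by rewrite leq_pmulr ?cardG_gt0.
by rewrite card_dihedral // -mul2n leq_pmul2l // leqNgt m_gt2.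
Qed.

(** The dihedral group of order 2m satisfies the relations, with its reflection
    in the role of x and its rotation in the role of y, since x^2n = 1 follows
    from x^2 = 1; by the universal property it is a quotient of G. *)
Lemma Unm_generators n m gT (G : {group gT}) : 2 < m -> is_Unm G n m ->
  exists x y, [/\ <[x]> <*> <[y]> = G :> {set gT}, y ^ x = y^-1 & ~~ abelian G].
Proof.
move=> m_gt2 hG; have m_gt1 := ltnW m_gt2.
case/existsP: (isoGrp_hom hG) => -[x y] /= /eqP[defG _ _ yx].
exists x, y; split=> //; first by rewrite conjgE mulgA.
suffices: [set: 'D_m.*2] \homg G.
  case/homgP=> f imf; apply: contra (dihedral_nonabelian m_gt2) => abG.
  by rewrite -imf morphim_abelian.
rewrite hG; case/existsP: (isoGrp_hom (Grp_dihedral m_gt1)) => -[u v] /=.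
case/eqP=> defD um v2 uv.
apply/existsP; exists (v, u); rewrite /= !xpair_eqE joingC defD um.
by rewrite -mulgA -conjgE uv expgM v2 expg1n !eqxx.
Qed.

(** The reason for which the graph is disconnected: conjugation by an element
    x^i y^j outside the centralizer of y inverts the powers of y, so that it
    fixes y^l only if y^l is its own inverse, hence commutes with x. *)
Lemma commuting_in_centralizer gT (G : {group gT}) x y a b :
    <[x]> <*> <[y]> = G :> {set gT} -> y ^ x = y^-1 -> ~~ abelian G ->
    a \in 'C_G[y] -> b \in G :\: 'C[y] -> commute a b -> a \in 'Z(G).
Proof.
move=> defG yx nabG.
have nyx : <[x]> \subset 'N(<[y]>).
  by rewrite cycle_subG; apply/normP; rewrite -cycleJ yx cycleV.
have genG g : g \in G -> exists i j, g = x ^+ i * y ^+ j.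
  rewrite -defG norm_joinEl // => /imset2P[_ _ /cycleP[i ->] /cycleP[j ->] ->].
  by exists i, j.
have ZG g : commute g x -> commute g y -> g \in G -> g \in 'Z(G).
  move=> gx gy Gg; apply/centerP; split=> // h /genG[i [j ->]].
  by apply: commuteM; apply: commuteX.
have xyC : y ^ x != y.
  apply: contra nabG => /eqP/conjg_fixP/commgP cyx.
  by rewrite -defG; apply: abelian_join_cycles.
have conj_y i j : y ^ (x ^+ i * y ^+ j) = if odd i then y^-1 else y.
  rewrite conjgM; have -> : y ^ (x ^+ i) = if odd i then y^-1 else y.
    elim: i => [|i IHi]; first by rewrite conjg1.
    by rewrite expgSr conjgM IHi /=; case: odd; rewrite ?conjVg yx ?invgK.
  by case: odd; rewrite ?conjVg conjgE commuteX // mulKg.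
have Cy g : (g \in 'C[y]) = (y ^ g == y).
  apply/cent1P/eqP=> [/commute_sym/commgP/conjg_fixP // |].
  by move/conjg_fixP/commgP/commute_sym.
case/setIP=> Ga Cya /setDP[Gb]; rewrite Cy => /eqP yb cab.
have [i [j bE]] := genG b Gb; have [k [l aE]] := genG a Ga.
have yb' : y ^ b = y^-1.
  by move: yb; rewrite bE conj_y; case: odd.
(* An odd [k] would make [y] its own inverse, so that [x] would fix it. *)
have ev_k : ~~ odd k.
  apply: contra xyC => odd_k.
  by move: Cya; rewrite Cy aE conj_y odd_k yx.
have xky : commute (x ^+ k) y.
  apply/cent1P; rewrite Cy.
  by have := conj_y k 0; rewrite mulg1 (negPf ev_k) => ->.
have xkb : commute (x ^+ k) b.
  by rewrite bE; apply: commuteM; [apply: commuteX2 | apply: commuteX].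
(* [y ^+ l] is [a] up to the power of [x], which commutes with [b]. *)
have ylb : (y ^+ l) ^ b = y ^+ l.
  have -> : y ^+ l = (x ^+ k)^-1 * a by rewrite aE mulKg.
  apply/conjg_fixP/commgP.
  by apply/commute_sym/commuteM => //; apply/commuteV/commute_sym.
apply: ZG Ga; last exact/cent1P.
rewrite aE; apply/commute_sym/commuteM; first exact: commuteX.
by apply/commute_sym/commgP/conjg_fixP; rewrite conjXg yx -yb' -conjXg.
Qed.

Lemma noncentral_classP (gT : finGroupType) (G : {group gT}) (A : {set gT}) a :
  A \in noncentral_classes G -> a \in A -> a \in G :\: 'Z(G) /\ A = a ^: G.
Proof.
case/imsetP=> c G'c -> ac; rewrite (class_eqP ac); split=> //.
apply: subsetP ac; rewrite class_sub_norm //.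
by rewrite normsD ?normG ?normal_norm ?center_normal.
Qed.

Theorem theorem3p3 (n m : nat) (gT : finGroupType) (G : {group gT})
    (hn : 2 <= n) (hm : 3 <= m) (hG : is_Unm G n m) :
  ~ CN_hyperenergetic (ccc_graph G).
Proof.
have [x [y [defG yx nabG]]] := Unm_generators hm hG.
have [Gx Gy] : x \in G /\ y \in G.
  by apply/andP; rewrite -defG -!cycle_subG joing_subl joing_subr.
pose C := 'C_G[y].
have xC : x \notin 'C[y].
  by apply: contra nabG => /cent1P cxy; rewrite -defG abelian_join_cycles.
have noncentral z w :
    z \in G -> w \in G -> z \notin 'C[w] -> z ^: G \in noncentral_classes G.
  move=> Gz Gw z'w; apply: imset_f; rewrite inE Gz andbT.
  by apply: contra z'w => /setIP[_ /centP cz]; apply/cent1P; apply: cz.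
have nCG : G \subset 'N(C).
  rewrite /C -cent_cycle normsI ?normG ?norms_cent //.
  rewrite -defG join_subG normG andbT.
  by rewrite cycle_subG; apply/normP; rewrite -cycleJ yx cycleV.
have Vx : x ^: G \in noncentral_classes G by apply: noncentral Gx Gy xC.
have Vy : y ^: G \in noncentral_classes G.
  by apply: noncentral Gy Gx _; rewrite cent1C.
pose vertex := exist (fun A : {set gT} => A \in noncentral_classes G).
pose vx : ccc_graph G := vertex _ Vx; pose vy : ccc_graph G := vertex _ Vy.
pose S := [set A : ccc_graph G | val A \subset C].
apply: (@disconnected_not_CN_hyperenergetic _ S vy vx).
- by rewrite inE class_sub_norm // inE Gy cent1id.
- rewrite inE; apply: contra xC => /subsetP/(_ x (class_refl _ _)).
  by case/setIP.
move=> A B; rewrite !inE => AC BC.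
apply/negP=> /andP[_ /exists_inP[a Aa /exists_inP[b Bb /eqP ab]]].
have [/setDP[Ga /negP Z'a] _] := noncentral_classP (valP A) Aa.
have [/setDP[Gb _] B_b] := noncentral_classP (valP B) Bb.
case: Z'a; apply: (commuting_in_centralizer defG yx nabG (subsetP AC a Aa) _ ab).
rewrite inE Gb andbT; apply: contra BC => Cb.
by rewrite B_b class_sub_norm // inE Gb.
Qed.
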